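(* For every integer $p\ge 1$, \[ \sum_{n=1}^\infty H_n^p \Big(T_n(2) - \frac{1}{n}\Big) = - (-1)^p p!\, (\zeta(2) - 1) - \sum_{I \vDash p} \binom{p}{I} \zeta(I^+) - \sum_{k=1}^{p-1} \sum_{I \vDash k} \frac{(-1)^{p-k} p!}{(i_1+1)\, k!} \binom{k}{I} \zeta(I^+) - \sum_{k=1}^{p-1} \sum_{I \vDash k} \frac{(-1)^{p-k} p!}{(i_1+1)\, k!} \binom{k}{I}\, i_1\, \zeta(2,I) , \] where for a composition $I=(i_1,i_2,\dots,i_d)$, $I^+$ means $(i_1+1,i_2,\dots,i_d)$.
   Context: $H_n=\sum_{i=1}^n 1/i$ and $H_n^p=(H_n)^p$. $T_n(2)=\sum_{j=n+1}^\infty \frac1{j^2}=\zeta(2)-\sum_{j=1}^n\frac1{j^2}$. For positive integers $a_1,\dots,a_k$ with $a_1\ge2$, the multiple zeta value is $\zeta(a_1,\dots,a_k)=\sum_{n_1>n_2>\dots>n_k\ge 1} n_1^{-a_1}\cdots n_k^{-a_k}$. $I\vDash m$ means that $I=(i_1,\dots,i_d)$ is a composition of $m$ (ordered tuple of positive integers with sum $m$), $i_1$ is its first part, and $\binom{m}{I}=\frac{m!}{i_1!\cdots i_d!}$. $\zeta(2,I)$ means $\zeta(2,i_1,\dots,i_d)$. *)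

(* Defs.v *)
From mathcomp Require Import all_boot all_order all_algebra.
From mathcomp Require Import all_classical all_reals all_analysis.

Set Implicit Arguments.
Unset Strict Implicit.
Unset Printing Implicit Defensive.

Import Order.TTheory GRing.Theory Num.Theory.
Import numFieldNormedType.Exports.

Local Open Scope classical_set_scope.
Local Open Scope ring_scope.

Definition harmonic_number (R : realType) (n : nat) : R :=
  \sum_(1 <= i < n.+1) i%:R^-1.

Definition zeta2_tail (R : realType) (n : nat) : R :=
  limn (fun N : nat => \sum_(n.+1 <= j < N.+1) (j%:R ^- 2 : R)).

(* The index tuples n_1 > ... > n_k >= 1. *)
Definition mzv_index (k : nat) : set (seq nat) :=
  [set n : seq nat | [/\ size n = k, sorted gtn n & 0%N \notin n]].

(* The terms are nonnegative, so the multiple series is an unordered sum in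
   the extended reals; [fine] returns 0 on a divergent (a_1 = 1) one. *)
Definition mzv (R : realType) (a : seq nat) : R :=
  fine (\esum_(n in mzv_index (size a))
          (\prod_(x <- zip n a) x.1%:R ^- x.2)%:E).

Definition compositions (m : nat) : set (seq nat) :=
  [set I : seq nat | 0%N \notin I /\ sumn I = m].

Definition multinomial (R : realType) (m : nat) (I : seq nat) : R :=
  m`!%:R / \prod_(i <- I) i`!%:R.

(* I^+; the value on the empty sequence is never used. *)
Definition incr_head (I : seq nat) : seq nat :=
  if I is i :: J then i.+1 :: J else [::].

(* Sums over [compositions m] use the finitely supported \sum_(_ \in _), which
   is the intended finite sum because of this fact. *)
Lemma finite_compositions (m : nat) : finite_set (compositions m).
Proof.
elim/ltn_ind: m => m IH.
apply: (@sub_finite_set _ _ ([set [::]] `|`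
  \bigcup_(i in `I_m) (cons i.+1 @` compositions (m - i.+1)%N))).
  case=> [_|i J [/=]]; first by left.
  case: i => [|i]; first by rewrite inE eqxx.
  rewrite inE negb_or => /andP[_ J0] def_m; right.
  exists i => /=; first by rewrite -def_m ltn_addr.
  by exists J => //; split=> //; rewrite -def_m addKn.
rewrite finite_setU; split; first exact: finite_set1.
apply: bigcup_finite => [|i /= im]; first exact: finite_II.
by apply/finite_image/IH; rewrite ltn_subrL /= (leq_ltn_trans _ im).
Qed.

(* Main.v *)
Require Import Defs.
From mathcomp Require Import all_boot all_order all_algebra.
From mathcomp Require Import all_classical all_reals all_analysis.
From mathcomp Require Import ring lra.
Import Order.TTheory GRing.Theory Num.Theory.
Import numFieldNormedType.Exports.
Local Open Scope classical_set_scope.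
Local Open Scope ring_scope.

(** Write H_n for the harmonic numbers, T_n for the tail of zeta(2), and put

      c_k = (-1)^(p-k) p!/k!,    P(x) = sum_(k <= p) c_k x^k.

    The polynomial P satisfies P + P' = x^p; equivalently c_p = 1 and
    (k+1) c_(k+1) = - c_k.  Since H_n grows by 1/n at step n, the sum
    F_j = sum_(n < j) H_n^p is a discrete analogue of the integral of log^p,
    and it equals j P(H_(j-1)) up to a constant and a correction built from the
    defects

      E_k(m) = H_(m+1)^k - (m+1) int_(H_m)^(H_(m+1)) t^k dt,

    the differences between a power of the harmonic number at the end of a step
    and its mean over that step ([sum_pow_ibp]).

    Replace every multiple zeta value on the right-hand side by the finite sum
    over indices at most N.  The multinomial theorem
    sum_(I |= q) binom(q, I) zeta_N(I) = H_N^q ([sum_multinomial_zsum]),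
    applied after splitting off the first part of I
    ([sum_multinomial_first]), turns the three sums over compositions into
    single sums over j < N: the zeta(I^+) over compositions of p give
    differences of H^p, those weighted by 1/(i_1 + 1) give integrals of t^k
    over steps of the harmonic sequence, and the terms zeta(2, I) weighted by
    i_1/(i_1 + 1) give the defects.  Summed against c_k everything telescopes,
    and the truncated right-hand side is

      P(H_N) + sum_(j <= N) (F_j / j^2 - H_j^p / j)          ([rhs_truncE]).

    Abel summation with T_(n-1) - T_n = 1/n^2 gives for the left-hand side

      T_N F_(N+1) + sum_(j <= N) (F_j / j^2 - H_j^p / j)     ([lhs_truncE]).

    Both sides contain divergent sums, but these are literally the same, so
    only the boundary term T_N F_(N+1) - P(H_N) is left.  It tends to 0
    ([boundary_cvg0]): (N+1) T_N = 1 + O(1/N), and F_(N+1) is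
    (N+1) P(H_N) up to an error bounded by a linear combination of powers of H_N.  Finally the truncated right-hand
    side converges because each multiple zeta value in it does
    ([rhs_trunc_cvg]). *)

(** * Truncated multiple zeta values *)

(** The multiple zeta value of [a] truncated to indices n_1 <= N: the summand for
    n_1 = j + 1 has its remaining indices at most j. *)
Fixpoint zsum (R : realType) (a : seq nat) (N : nat) : R :=
  if a is i :: s then \sum_(j < N) (j.+1%:R ^- i * zsum R s j) else 1.

Lemma zsum_cons0 (R : realType) i s : zsum R (i :: s) 0 = 0.
Proof. by rewrite /= big_ord0. Qed.

Lemma zsum_consS (R : realType) i s N :
  zsum R (i :: s) N.+1 = zsum R (i :: s) N + N.+1%:R ^- i * zsum R s N.
Proof. by rewrite /= big_ord_recr. Qed.

Lemma zsum_ge0 (R : realType) a N : 0 <= zsum R a N.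
Proof.
elim: a N => [|i s IH] N //=; apply: sumr_ge0 => j _.
by rewrite mulr_ge0 // invr_ge0 exprn_ge0.
Qed.

Lemma zsum_nondecreasing (R : realType) a : nondecreasing_seq (zsum R a).
Proof.
apply/nondecreasing_seqP => N; case: a => [|i s] //.
by rewrite zsum_consS lerDl mulr_ge0 ?zsum_ge0 // invr_ge0 exprn_ge0.
Qed.

Definition mzv_index_le (k N : nat) : set (seq nat) :=
  mzv_index k `&` [set n | all (leq^~ N) n].

Lemma mzv_index_le0 k : mzv_index_le k.+1 0 = set0.
Proof.
apply/seteqP; split=> // -[|x n] [[]] //= _ _ n0 /andP[].
by rewrite leqn0 => /eqP x0; rewrite x0 inE in n0.
Qed.

Lemma mzv_index_le_nil N : mzv_index_le 0 N = [set [::]].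
Proof. by apply/seteqP; split=> [[|x n] [[]]|_ ->]. Qed.

(** The recursion of [zsum] on its bound, on the level of index tuples: either
    n_1 <= N, or n_1 = N + 1 and the other entries are at most N. *)
Lemma mzv_index_leS k N : mzv_index_le k.+1 N.+1 =
  mzv_index_le k.+1 N `|` cons N.+1 @` mzv_index_le k N.
Proof.
apply/seteqP; split=> [[|x n] [[]] //= [size_n] sorted_n|n].
  rewrite inE negb_or => /andP[x0 n0] /andP[xN nN].
  move: (sorted_n); rewrite path_sortedE; last exact: rev_trans ltn_trans.
  move=> /andP[n_lt_x sorted'_n]; move: xN; rewrite leq_eqVlt => /orP[/eqP xE|xN].
    right; exists n; rewrite ?xE //; split=> //.
    by apply: sub_all n_lt_x => y /=; rewrite xE.
  left; split; first by split; rewrite //= ?size_n // inE negb_or x0.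
  rewrite /= -ltnS xN; apply: sub_all n_lt_x => y /= yx.
  by rewrite -ltnS (ltn_trans yx).
case=> [[idx nN]|[m [[size_m sorted_m m0] mN] <-]].
  by split=> //; apply: sub_all nN => y /= /leqW.
split; last by rewrite /= leqnn; apply: sub_all mN => y /= /leqW.
split; rewrite /= ?size_m //.
by rewrite path_sortedE; [rewrite sorted_m andbT|exact: rev_trans ltn_trans].
Qed.

Lemma finite_mzv_index_le k N : finite_set (mzv_index_le k N).
Proof.
elim: k N => [|k IHk] N; first by rewrite mzv_index_le_nil.
elim: N => [|N IHN]; first by rewrite mzv_index_le0.
by rewrite mzv_index_leS finite_setU; split=> //; exact: finite_image.
Qed.

Lemma sum_mzv_index_le (R : realType) (a : seq nat) N :
  \sum_(n \in mzv_index_le (size a) N) \prod_(x <- zip n a) (x.1%:R ^- x.2 : R)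
  = zsum R a N.
Proof.
elim: a N => [|i s IHs] N.
  by rewrite mzv_index_le_nil fsbig_set1 big_nil.
elim: N => [|N IHN]; first by rewrite mzv_index_le0 fsbig_set0 zsum_cons0.
rewrite [size _]/= mzv_index_leS fsbigU0; last first.
- by move=> n [[_ +] [m _ def_n]]; rewrite -def_n /= ltnn.
- exact/finite_image/finite_mzv_index_le.
- exact: finite_mzv_index_le.
rewrite IHN zsum_consS fsbig_image; last by move=> u v _ _ [].
by rewrite -IHs mulr_fsumr; congr (_ + _); apply: eq_fsbigr => n _; rewrite big_cons.
Qed.

(** Every finite set of index tuples is contained in one of the finite sets
    [mzv_index_le], whose sums are the [zsum]s; so the unordered sum is the
    supremum of the nondecreasing sequence [zsum].  Boundedness makes this
    supremum finite, so that [fine] returns it. *)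
Lemma mzv_cvg (R : realType) (a : seq nat) :
  (exists C, forall N, zsum R a N <= C) -> zsum R a @ \oo --> mzv R a.
Proof.
move=> [C zsum_le]; pose w n : R := \prod_(x <- zip n a) x.1%:R ^- x.2.
have w_ge0 n : 0 <= w n.
  by apply: prodr_ge0 => x _; rewrite invr_ge0 exprn_ge0.
have zsum_sup : has_ubound (range (zsum R a)).
  by exists C => _ [N _ <-].
suff -> : mzv R a = sup (range (zsum R a)).
  by apply: nondecreasing_cvgn => //; exact: zsum_nondecreasing.
rewrite /mzv; suff -> : \esum_(n in mzv_index (size a)) (w n)%:E =
    (sup (range (zsum R a)))%:E by [].
apply/eqP; rewrite eq_le; apply/andP; split.
  apply: ge_ereal_sup => _ [F [finF sub_F] <-].
  have [N F_le] : exists N, F `<=` mzv_index_le (size a) N.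
    have /finite_seqP[r F_r] := finF.
    exists (\max_(n <- r) \max_(x <- n) x)%N => n Fn.
    split; first exact: sub_F.
    apply/allP => x xn.
    apply: (@leq_trans (\max_(y <- n) y)%N).
      exact: (@leq_bigmax_seq _ n xpredT id).
    apply: (@leq_bigmax_seq _ r xpredT (fun n => \max_(y <- n) y)%N) => //.
    by rewrite F_r in Fn.
  rewrite fsumEFin // lee_fin.
  apply: le_trans (ub_le_sup zsum_sup (imageT _ N)).
  rewrite -sum_mzv_index_le -lee_fin -!fsumEFin //; last exact: finite_mzv_index_le.
  apply: lee_fsum_nneg_subset => //; first exact: finite_mzv_index_le.
    exact/subsetP.
  by move=> n _; rewrite lee_fin.
rewrite -(@ereal_sup_EFin _ (range _)) //; last by exists (zsum R a 0), 0%N.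
apply: ge_ereal_sup => _ [_ [N _ <-] <-].
apply: esum_ge; exists (mzv_index_le (size a) N).
  by split; [exact: finite_mzv_index_le|move=> n []].
by rewrite fsumEFin ?sum_mzv_index_le //; exact: finite_mzv_index_le.
Qed.

(** * Sums over compositions *)

(** A nonempty composition is its first part followed by a composition of the
    rest; summing by first part is how all sums over compositions are
    evaluated below. *)
Lemma sum_compositionsS (V : nmodType) k (Phi : seq nat -> V) :
  \sum_(I \in compositions k.+1) Phi I
  = \sum_(1 <= i < k.+2) \sum_(J \in compositions (k.+1 - i)) Phi (i :: J).
Proof.
(* Admit first parts up to m only, and let m grow. *)
pose C m := compositions k.+1 `&` [set I | (head 0%N I <= m)%N].
have finC m : finite_set (C m) by exact/finite_setIl/finite_compositions.
suff sumC m : (m <= k.+1)%N -> \sum_(I \in C m) Phi I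
    = \sum_(1 <= i < m.+1) \sum_(J \in compositions (k.+1 - i)) Phi (i :: J).
  rewrite -sumC //; apply: eq_fsbigl; apply/seteqP; split=> [|I []//].
  move=> I [I0 sumI]; split=> //.
  by case: I I0 sumI => //= i J _ <-; rewrite leq_addr.
elim: m => [_|m IHm m_le]; first rewrite big_geq // fsbig1 //.
  case=> [|i J] [[]] //= i0 _; rewrite leqn0 => /eqP iE.
  by rewrite iE inE in i0.
rewrite big_nat_recr //= -IHm 1?ltnW //.
rewrite -(@fsbig_image _ _ _ _ _ _ (cons m.+1)); last by move=> u v _ _ [].
have -> : C m.+1 = C m `|` cons m.+1 @` compositions (k.+1 - m.+1).
  apply/seteqP; split=> [[|i J] [[]] //= i0 sumI|I].
    rewrite leq_eqVlt ltnS => /orP[/eqP iE|im]; last by left.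
    right; exists J; rewrite ?iE //; split; last by rewrite -sumI iE addKn.
    by move: i0; rewrite inE negb_or => /andP[].
  case=> [[CI /leqW Im]|[J [J0 sumJ] <-]]; first by split.
  split; last exact: leqnn.
  by split; rewrite ?inE //= sumJ subnKC.
rewrite fsbigU0 //; first exact/finite_image/finite_compositions.
by move=> I [[_ +] [J _ def_I]]; rewrite -def_I /= ltnn.
Qed.

Lemma compositions0 : compositions 0 = [set [::]].
Proof. by apply/seteqP; split=> [[|[|i] I] []|_ ->]. Qed.

Lemma multinomial_cons (R : realType) k i J : (i <= k)%N ->
  multinomial R k (i :: J) = 'C(k, i)%:R * multinomial R (k - i) J.
Proof.
move=> ik; rewrite /multinomial big_cons -(bin_fact ik) !natrM.
have := fact_gt0 i; rewrite lt0n -(pnatr_eq0 R) => i0.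
by rewrite invfM !mulrA; congr (_ / _); rewrite mulrAC mulfK.
Qed.

Lemma harmonic_number0 (R : realType) : harmonic_number R 0 = 0.
Proof. by rewrite /harmonic_number big_geq. Qed.

Lemma harmonic_numberS (R : realType) n :
  harmonic_number R n.+1 = harmonic_number R n + n.+1%:R^-1.
Proof. by rewrite /harmonic_number big_nat_recr. Qed.

(** The binomial theorem without its term i = 0; here i plays the role of the
    first part of a composition. *)
Lemma exprDn_first (R : comPzRingType) (x y : R) k :
  \sum_(1 <= i < k.+1) 'C(k, i)%:R * x ^+ (k - i) * y ^+ i
  = (x + y) ^+ k - x ^+ k.
Proof.
rewrite exprDn -(big_mkord xpredT (fun i => x ^+ (k - i) * y ^+ i *+ 'C(k, i))).
rewrite big_ltn // subn0 expr0 mulr1 bin0 mulr1n addrAC subrr add0r.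
by apply: eq_bigr => i _; rewrite -mulrA mulr_natl.
Qed.

(** Expand the power of 1 + 1/2 + ... + 1/N and group the monomials by the
    exponents that occur, in decreasing order of the index.  In the induction,
    passing from N to N + 1 adds the tuples with n_1 = N + 1, and splitting off
    the first part reduces these to the binomial theorem for
    (H_N + 1/(N+1))^q. *)
Lemma sum_multinomial_zsum (R : realType) q N :
  \sum_(J \in compositions q) multinomial R q J * zsum R J N
  = harmonic_number R N ^+ q.
Proof.
elim: N q => [|N IHN] [|k].
- by rewrite compositions0 fsbig_set1 /multinomial big_nil mulr1 divr1.
- rewrite harmonic_number0 expr0n fsbig1 //.
  by case=> [[]|i J _] //; rewrite zsum_cons0 mulr0.
- by rewrite compositions0 fsbig_set1 /multinomial big_nil mulr1 divr1.
rewrite sum_compositionsS.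
under eq_big_nat => i ik.
  under eq_fsbigr do rewrite zsum_consS mulrDr.
  rewrite fsbig_split /=; last exact: finite_compositions.
  rewrite [X in _ + X](_ : _ = 'C(k.+1, i)%:R * harmonic_number R N ^+ (k.+1 - i)
      * N.+1%:R^-1 ^+ i).
    over.
  rewrite -IHN mulrAC mulr_fsumr; apply: eq_fsbigr => J _.
  by rewrite multinomial_cons ?exprVn; [ring|case/andP: ik].
rewrite big_split /=.
rewrite -(@sum_compositionsS _ k (fun J => multinomial R k.+1 J * zsum R J N)).
by rewrite IHN exprDn_first -harmonic_numberS addrC subrK.
Qed.

(** Keep the first part i apart: it may be weighted by [g] and its exponent
    changed by [h], while the remaining parts are summed by
    [sum_multinomial_zsum]. *)
Lemma sum_multinomial_first (R : realType) k (g : nat -> R) (h : nat -> nat) N :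
  \sum_(I \in compositions k.+1)
    multinomial R k.+1 I * g (head 0%N I) * zsum R (h (head 0%N I) :: behead I) N
  = \sum_(j < N) \sum_(1 <= i < k.+2) g i * ('C(k.+1, i)%:R
      * harmonic_number R j ^+ (k.+1 - i) * j.+1%:R^-1 ^+ h i).
Proof.
rewrite sum_compositionsS exchange_big /=; apply: eq_big_nat => i ik.
have {ik} ik : (i <= k.+1)%N by case/andP: ik.
elim: N => [|N IHN].
  by rewrite big_ord0 fsbig1 // => J _; rewrite big_ord0 mulr0.
rewrite big_ord_recr /= -IHN -sum_multinomial_zsum.
rewrite mulrAC mulrA mulr_fsumr -fsbig_split; last exact: finite_compositions.
apply: eq_fsbigr => J _; rewrite big_ord_recr /= mulrDr multinomial_cons ?exprVn //.
congr (_ + _); ring.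
Qed.

(** * Integration by parts for powers of harmonic numbers *)

(** The integral of t^k from a to b. *)
Definition pow_int (R : fieldType) k (a b : R) : R :=
  (b ^+ k.+1 - a ^+ k.+1) / k.+1%:R.

(** Integrating the binomial theorem for (x + t)^k over 0 <= t <= y produces the
    weights 1/(i+1); the term i = 0 is the one subtracted on the right. *)
Lemma pow_int_first (R : numFieldType) (x y : R) k :
  \sum_(1 <= i < k.+1)
    i.+1%:R^-1 * ('C(k, i)%:R * x ^+ (k - i) * y ^+ i.+1)
  = pow_int R k x (x + y) - x ^+ k * y.
Proof.
rewrite /pow_int -exprDn_first [in RHS]big_ltn // [in RHS]big_add1 /= mulrDl bin1.
rewrite subSS subn0 expr1.
have k0 : k.+1%:R != 0 :> R by rewrite pnatr_eq0.
rewrite (_ : k.+1%:R * _ * _ / _ = x ^+ k * y); last by field.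
rewrite [RHS]addrC addrA addNr add0r mulr_suml; apply: eq_bigr => i _.
have i0 : i.+1%:R != 0 :> R by rewrite pnatr_eq0.
have : i.+1%:R * 'C(k.+1, i.+1)%:R = k.+1%:R * 'C(k, i)%:R :> R.
  by rewrite -!natrM -mul_bin_diag.
rewrite subSS => /(canRL (mulKf i0)) ->; field.
by rewrite ?(addrC _ 1) ?nat1r i0 k0.
Qed.

(** The coefficients of repeated integration by parts:
    e^x x^p has the antiderivative e^x sum_k c_k x^k. *)
Definition ibp_coef (R : realType) (p k : nat) : R :=
  (-1) ^+ (p - k) * p`!%:R / k`!%:R.

Definition ibp_poly (R : realType) (p : nat) (x : R) : R :=
  \sum_(k < p.+1) ibp_coef R p k * x ^+ k.

Lemma factr_neq0 (R : numDomainType) n : n`!%:R != 0 :> R.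
Proof. by rewrite pnatr_eq0 -lt0n fact_gt0. Qed.

Lemma ibp_coefS (R : realType) p k : (k < p)%N ->
  ibp_coef R p k.+1 * k.+1%:R = - ibp_coef R p k.
Proof.
move=> kp; rewrite /ibp_coef -(subnSK kp) exprS factS natrM.
have k0 : k.+1%:R != 0 :> R by rewrite pnatr_eq0.
by rewrite invfM mulrA mulrAC mulfVK // !mulN1r !mulNr opprK.
Qed.

Lemma ibp_coef_top (R : realType) p : ibp_coef R p p = 1.
Proof. by rewrite /ibp_coef subnn expr0 mul1r divff ?factr_neq0. Qed.

Lemma ibp_coef0 (R : realType) p : ibp_coef R p 0 = (-1) ^+ p * p`!%:R.
Proof. by rewrite /ibp_coef subn0 divr1. Qed.

Lemma ibp_poly0 (R : realType) p : ibp_poly R p 0 = ibp_coef R p 0.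
Proof.
rewrite /ibp_poly big_ord_recl expr0 mulr1 big1 ?addr0 // => i _.
by rewrite expr0n mulr0.
Qed.

(** Both sides are minus the derivative of P. *)
Lemma sum_ibp_coef_pow (R : realType) p (x : R) :
  \sum_(k < p) ibp_coef R p k * x ^+ k = ibp_poly R p x - x ^+ p.
Proof. by rewrite /ibp_poly big_ord_recr /= ibp_coef_top mul1r addrK. Qed.

(** Integrate [sum_ibp_coef_pow] from a to b. *)
Lemma sum_ibp_coef_pow_int (R : realType) p (a b : R) :
  \sum_(k < p) ibp_coef R p k * pow_int R k a b = ibp_poly R p a - ibp_poly R p b.
Proof.
rewrite /ibp_poly !big_ord_recl !expr0 opprD addrACA subrr add0r.
rewrite -sumrB; apply: eq_bigr => k _; rewrite /= /bump /= add1n /pow_int.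
have k0 : k.+1%:R != 0 :> R by rewrite pnatr_eq0.
rewrite -[ibp_coef R p k]opprK -ibp_coefS //.
by rewrite mulNr -mulrA [_ * (_ / _)]mulrC mulfVK //; ring.
Qed.

(** The value of t^k at the end of the interval [H_m, H_(m+1)], minus its mean
    over that interval, whose length is 1/(m+1). *)
Definition ibp_defect (R : realType) (k m : nat) : R :=
  harmonic_number R m.+1 ^+ k
  - m.+1%:R * pow_int R k (harmonic_number R m) (harmonic_number R m.+1).

(** Subtract the binomial expansions of the two terms:
    1 - 1/(i+1) = i/(i+1). *)
Lemma ibp_defectE (R : realType) k m :
  ibp_defect R k m = \sum_(1 <= i < k.+1) i%:R / i.+1%:R *
    ('C(k, i)%:R * harmonic_number R m ^+ (k - i) * m.+1%:R^-1 ^+ i).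
Proof.
have m0 : m.+1%:R != 0 :> R by rewrite pnatr_eq0.
set x := harmonic_number R m.
have := exprDn_first _ x m.+1%:R^-1 k; have := pow_int_first _ x m.+1%:R^-1 k.
rewrite /ibp_defect harmonic_numberS -/x; set u := pow_int _ _ _ _ => uE vE.
have -> : u = (u - x ^+ k * m.+1%:R^-1) + x ^+ k * m.+1%:R^-1 by rewrite subrK.
rewrite -uE mulrDr mulrCA mulfV // mulr1.
rewrite [LHS](_ : _ = (x + m.+1%:R^-1) ^+ k - x ^+ k - m.+1%:R * \sum_(1 <= i < k.+1)
    i.+1%:R^-1 * ('C(k, i)%:R * x ^+ (k - i) * m.+1%:R^-1 ^+ i.+1)); last by ring.
rewrite -vE mulr_sumr -sumrB; apply: eq_bigr => i _.
have i0 : i.+1%:R != 0 :> R by rewrite pnatr_eq0.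
rewrite exprSr; set z := _ ^+ i; rewrite -natr1 in i0 *; field.
by rewrite i0 nat1r m0.
Qed.

Lemma ibp_defect0 (R : realType) m : ibp_defect R 0 m = 0.
Proof. by rewrite ibp_defectE big_geq. Qed.

(** * The truncated right-hand side *)

Lemma sum_multinomial_incr_head (R : realType) p N : (0 < p)%N ->
  \sum_(I \in compositions p) multinomial R p I * zsum R (incr_head I) N
  = \sum_(j < N) (harmonic_number R j.+1 ^+ p - harmonic_number R j ^+ p) / j.+1%:R.
Proof.
case: p => // p _; transitivity (\sum_(I \in compositions p.+1)
    multinomial R p.+1 I * 1 * zsum R ((head 0%N I).+1 :: behead I) N).
  by apply: eq_fsbigr => -[|i I]; rewrite inE => -[] // _ _; rewrite mulr1.
rewrite (sum_multinomial_first _ _ (fun=> 1) succn); apply: eq_bigr => j _.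
rewrite harmonic_numberS -exprDn_first mulr_suml; apply: eq_bigr => i _.
by rewrite mul1r exprSr !mulrA.
Qed.

Lemma sum_multinomial_incr_head_inv (R : realType) k N : (0 < k)%N ->
  \sum_(I \in compositions k) multinomial R k I * (head 0%N I).+1%:R^-1
    * zsum R (incr_head I) N
  = \sum_(j < N) (pow_int R k (harmonic_number R j) (harmonic_number R j.+1)
                  - harmonic_number R j ^+ k / j.+1%:R).
Proof.
case: k => // k _; transitivity (\sum_(I \in compositions k.+1)
    multinomial R k.+1 I * (head 0%N I).+1%:R^-1
      * zsum R ((head 0%N I).+1 :: behead I) N).
  by apply: eq_fsbigr => -[|i I]; rewrite inE => -[].
rewrite (sum_multinomial_first _ _ (fun i => i.+1%:R^-1) succn).
by apply: eq_bigr => j _; rewrite harmonic_numberS -pow_int_first.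
Qed.

Lemma sum_multinomial_defect (R : realType) k N : (0 < k)%N ->
  \sum_(I \in compositions k) multinomial R k I
    * ((head 0%N I)%:R / (head 0%N I).+1%:R) * zsum R I N
  = \sum_(j < N) ibp_defect R k j.
Proof.
case: k => // k _; transitivity (\sum_(I \in compositions k.+1)
    multinomial R k.+1 I * ((head 0%N I)%:R / (head 0%N I).+1%:R)
      * zsum R (head 0%N I :: behead I) N).
  by apply: eq_fsbigr => -[|i I]; rewrite inE => -[].
rewrite (sum_multinomial_first _ _ (fun i => i%:R / i.+1%:R) id).
by apply: eq_bigr => j _; rewrite ibp_defectE.
Qed.

(** Discrete integration by parts.  Since P - x^p integrates to the decrease of P
    over a step, the sum over k of c_k E_k(m) equals
    (m+2) P(H_(m+1)) - (m+1) P(H_m) - H_(m+1)^p, and the first two terms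
    telescope. *)
Lemma sum_pow_ibp (R : realType) p N : (0 < p)%N ->
  \sum_(n < N.+1) harmonic_number R n ^+ p
  = N.+1%:R * ibp_poly R p (harmonic_number R N) - ibp_coef R p 0
    - \sum_(k < p) ibp_coef R p k * \sum_(m < N) ibp_defect R k m.
Proof.
move=> p0; elim: N => [|N IHN].
  rewrite big_ord1 harmonic_number0 expr0n eqn0Ngt p0 ibp_poly0.
  rewrite big1 => [|k _]; last by rewrite big_ord0 mulr0.
  by rewrite mul1r subr0 subrr.
rewrite big_ord_recr IHN /=.
have -> : \sum_(k < p) ibp_coef R p k * \sum_(m < N.+1) ibp_defect R k m
    = \sum_(k < p) ibp_coef R p k * \sum_(m < N) ibp_defect R k m
      + \sum_(k < p) ibp_coef R p k * harmonic_number R N.+1 ^+ k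
      - N.+1%:R * \sum_(k < p) ibp_coef R p k
          * pow_int R k (harmonic_number R N) (harmonic_number R N.+1).
  rewrite mulr_sumr -big_split -sumrB /=; apply: eq_bigr => k _.
  by rewrite big_ord_recr /= /ibp_defect; ring.
rewrite sum_ibp_coef_pow sum_ibp_coef_pow_int -[N.+2%:R]natr1.
by ring.
Qed.

(** The right-hand side of the theorem with [zsum] in place of [mzv]. *)
Definition rhs_trunc (R : realType) (p N : nat) : R :=
  - (-1) ^+ p * p`!%:R * (zsum R [:: 2%N] N - 1)
   - \sum_(I \in compositions p) (multinomial R p I * zsum R (incr_head I) N)
   - \sum_(1 <= k < p) \sum_(I \in compositions k)
       ((-1) ^+ (p - k)%N * p`!%:R / ((head 0%N I).+1%:R * k`!%:R)
        * multinomial R k I * zsum R (incr_head I) N)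
   - \sum_(1 <= k < p) \sum_(I \in compositions k)
       ((-1) ^+ (p - k)%N * p`!%:R / ((head 0%N I).+1%:R * k`!%:R)
        * multinomial R k I * (head 0%N I)%:R * zsum R (2%N :: I) N).

(** Once the sums over compositions have become sums over j < N, the increments
    of both sides in N agree: the integrals of t^k contribute differences of P,
    and [sum_pow_ibp] brings in the sums of H_n^p. *)
Lemma rhs_truncE (R : realType) (p N : nat) : (0 < p)%N -> rhs_trunc R p N =
  ibp_poly R p (harmonic_number R N)
  + \sum_(j < N) ((\sum_(n < j.+1) harmonic_number R n ^+ p) / j.+1%:R ^+ 2
                  - harmonic_number R j.+1 ^+ p / j.+1%:R).
Proof.
move=> p0; pose H := harmonic_number R; pose c := ibp_coef R p.
have sum3 : \sum_(1 <= k < p) \sum_(I \in compositions k)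
       ((-1) ^+ (p - k)%N * p`!%:R / ((head 0%N I).+1%:R * k`!%:R)
        * multinomial R k I * zsum R (incr_head I) N)
    = \sum_(j < N) \sum_(k < p) c k * (pow_int R k (H j) (H j.+1) - H j ^+ k / j.+1%:R).
  rewrite exchange_big /= -(big_mkord xpredT (fun k => \sum_(j < N) c k
      * (pow_int R k (H j) (H j.+1) - H j ^+ k / j.+1%:R))).
  (* The term k = 0, absent on the left, vanishes. *)
  rewrite [RHS]big_ltn // [X in X + _]big1 ?add0r => [|j _]; last first.
    by rewrite /pow_int divr1 !expr1 expr0 /H harmonic_numberS; ring.
  apply: eq_big_nat => k /andP[k0 _]; rewrite -mulr_sumr.
  rewrite -sum_multinomial_incr_head_inv // mulr_fsumr; apply: eq_fsbigr => I _.
  by rewrite /c /ibp_coef invfM; ring.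
have sum4 : \sum_(1 <= k < p) \sum_(I \in compositions k)
       ((-1) ^+ (p - k)%N * p`!%:R / ((head 0%N I).+1%:R * k`!%:R)
        * multinomial R k I * (head 0%N I)%:R * zsum R (2%N :: I) N)
    = \sum_(j < N) j.+1%:R ^- 2 * \sum_(k < p) c k * \sum_(m < j) ibp_defect R k m.
  under [RHS]eq_bigr do rewrite mulr_sumr.
  rewrite exchange_big /= -(big_mkord xpredT (fun k => \sum_(j < N) j.+1%:R ^- 2
      * (c k * \sum_(m < j) ibp_defect R k m))).
  rewrite [RHS]big_ltn // [X in X + _]big1 ?add0r => [|j _]; last first.
    by rewrite big1 ?mulr0 // => m _; rewrite ibp_defect0.
  apply: eq_big_nat => k /andP[k0 _].
  under [RHS]eq_bigr do rewrite -sum_multinomial_defect //.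
  elim: N {sum3} => [|N IHN].
    by rewrite big_ord0 fsbig1 // => I _; rewrite big_ord0 mulr0.
  rewrite big_ord_recr -IHN /= !mulr_fsumr -fsbig_split; last exact: finite_compositions.
  apply: eq_fsbigr => I _; rewrite big_ord_recr /= /c /ibp_coef invfM; ring.
rewrite /rhs_trunc {}sum3 {}sum4 sum_multinomial_incr_head //.
rewrite !mulNr -ibp_coef0 -/H -/c.
elim: N => [|N IHN].
  by rewrite zsum_cons0 !big_ord0 /H harmonic_number0 ibp_poly0 -/c; ring.
rewrite zsum_consS mulr1.
move: IHN; set u := zsum _ _ _ => IHN.
rewrite ![\sum_(j < N.+1) _]big_ord_recr /=.
have -> : \sum_(k < p) c k * (pow_int R k (H N) (H N.+1) - H N ^+ k / N.+1%:R)
    = ibp_poly R p (H N) - ibp_poly R p (H N.+1)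
      - (ibp_poly R p (H N) - H N ^+ p) / N.+1%:R.
  rewrite -sum_ibp_coef_pow_int -sum_ibp_coef_pow mulr_suml -sumrB.
  by apply: eq_bigr => k _; rewrite /c; ring.
have -> : \sum_(k < p) c k * \sum_(m < N) ibp_defect R k m
  = N.+1%:R * ibp_poly R p (H N) - c 0%N - \sum_(n < N.+1) H n ^+ p.
  by rewrite sum_pow_ibp // subKr.
have N0 : N.+1%:R != 0 :> R by rewrite pnatr_eq0.
move: IHN; set s1 := \sum_(j < N) _; set s2 := \sum_(j < N) _.
set s3 := \sum_(j < N) _; set s4 := \sum_(j < N) _.
move=> IHN; have -> : s4 = - (c 0%N * (u - 1)) - s2 - s1 - s3 - ibp_poly R p (H N).
  by rewrite IHN addrC addKr.
rewrite [\sum_(n < N.+1) _]big_ord_recr /=.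
by field; rewrite nat1r.
Qed.

(** * Growth of harmonic numbers and convergence of multiple zeta values *)

(** This identity lets sums of inverse squares be compared with telescoping
    sums. *)
Lemma invSB (R : numFieldType) n :
  n.+1%:R^-1 - n.+2%:R^-1 = n.+1%:R^-1 * n.+2%:R^-1 :> R.
Proof.
rewrite -[n.+2%:R]natr1; field.
by rewrite ?nat1r ?natr1 !pnatr_eq0.
Qed.

Lemma harmonic_numberE (R : realType) N : harmonic_number R N = \sum_(j < N) j.+1%:R^-1.
Proof. by rewrite /harmonic_number big_add1 big_mkord. Qed.

Lemma harmonic_number_ge0 (R : realType) n : 0 <= harmonic_number R n.
Proof. by rewrite harmonic_numberE; apply: sumr_ge0 => i _; rewrite invr_ge0. Qed.

Lemma harmonic_number_leS (R : realType) n : harmonic_number R n <= harmonic_number R n.+1.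
Proof. by rewrite harmonic_numberS lerDl invr_ge0. Qed.

Lemma harmonic_number_nondecreasing (R : realType) : nondecreasing_seq (harmonic_number R).
Proof. exact/nondecreasing_seqP/harmonic_number_leS. Qed.

(** The mean value inequality for t^d on [a, b]. *)
Lemma exprB_le (R : realDomainType) (a b : R) d : 0 <= a <= b ->
  b ^+ d - a ^+ d <= d%:R * b ^+ d.-1 * (b - a).
Proof.
move=> /andP[a0 ab]; rewrite subrXX mulrC ler_wpM2r ?subr_ge0 //.
rewrite mulr_natl -[X in _ *+ X]card_ord -sumr_const; apply: ler_sum => i _.
have i_le : (i <= d.-1)%N by case: d i => [|d] [].
rewrite -[in leRHS](subnK i_le) exprD ler_wpM2l ?exprn_ge0 ?(le_trans a0) //.
by rewrite lerXn2r // nnegrE (le_trans a0).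
Qed.

Lemma exprB_harmonic_le (R : realType) d n :
  harmonic_number R n.+1 ^+ d - harmonic_number R n ^+ d
  <= d%:R * harmonic_number R n.+1 ^+ d.-1 / n.+1%:R.
Proof.
apply: le_trans (@exprB_le _ _ _ d _) _.
  by rewrite harmonic_number_ge0 harmonic_number_leS.
suff -> : harmonic_number R n.+1 - harmonic_number R n = n.+1%:R^-1 by [].
by rewrite harmonic_numberS addrAC subrr add0r.
Qed.

(** Summation by parts: compared with the telescoping differences of 1/j, the sum
    for d is bounded by a constant plus a multiple of the sum for d - 1, because
    H_(j+1)^d - H_j^d is at most d H_(j+1)^(d-1) / (j+1). *)
Lemma sum_harmonic_pow_bounded (R : realType) d :
  exists C, forall N, \sum_(j < N) harmonic_number R j.+1 ^+ d / j.+1%:R ^+ 2 <= C.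
Proof.
pose H := harmonic_number R.
have parts e N : \sum_(j < N) H j.+1 ^+ e / j.+1%:R ^+ 2
    <= 2 + 2 * e%:R * \sum_(j < N.+1) H j.+1 ^+ e.-1 / j.+1%:R ^+ 2.
  have le2 : 2 * (1 - H N.+1 ^+ e / N.+1%:R) <= 2.
    by rewrite ler_piMr // lerBlDr lerDl divr_ge0 // exprn_ge0 ?harmonic_number_ge0.
  apply: (@le_trans _ _ (2 * (1 - H N.+1 ^+ e / N.+1%:R)
      + 2 * e%:R * \sum_(j < N) H j.+2 ^+ e.-1 / j.+2%:R ^+ 2)); last first.
    rewrite lerD // ler_wpM2l ?mulr_ge0 // [leRHS]big_ord_recl lerDr.
    by rewrite divr_ge0 ?exprn_ge0 ?harmonic_number_ge0.
  elim: N {le2} => [|N IHN].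
    rewrite !big_ord0 mulr0 addr0 /H harmonic_numberS harmonic_number0 add0r.
    by rewrite invr1 expr1n mulr1 subrr mulr0.
  rewrite !big_ord_recr /=; apply: le_trans (lerD IHN (lexx _)) _.
  have := exprB_harmonic_le R e N.+1; rewrite -/H.
  have : 0 <= H N.+1 ^+ e by rewrite exprn_ge0 ?harmonic_number_ge0.
  set u := H N.+1 ^+ e; set v := H N.+2 ^+ e; set w := H N.+2 ^+ e.-1.
  set S := \sum_(j < N) _ => u0 vu.
  have r_gt0 : 0 < N.+1%:R^-1 :> R by rewrite invr_gt0.
  have s_gt0 : 0 < N.+2%:R^-1 :> R by rewrite invr_gt0.
  (* 1/k^2 <= 2 / (k (k+1)), the factor 2 in the bound. *)
  have sq_le : u / N.+1%:R ^+ 2 <= 2 * u * (N.+1%:R^-1 - N.+2%:R^-1).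
    rewrite (mulrC 2) -mulrA ler_wpM2l //.
    rewrite invSB -exprVn expr2 mulrCA ler_wpM2l ?(ltW r_gt0) //.
    by rewrite ler_pdivlMr // ler_pdivrMl // -natrM ler_nat muln2 -addnn addSn ltnS leq_addl.
  have := ler_wpM2r (ltW s_gt0) vu; move: sq_le; rewrite -!exprVn.
  move: (N.+1%:R^-1) (N.+2%:R^-1) => r s.
  lra.
elim: d => [|d [C leC]].
  by exists 2 => N; apply: le_trans (parts _ _) _; rewrite mulr0 mul0r addr0.
exists (2 + 2 * d.+1%:R * C) => N; apply: le_trans (parts _ _) _.
by rewrite lerD2l ler_wpM2l ?mulr_ge0.
Qed.

Lemma zsum_le_harmonic (R : realType) (s : seq nat) N : 0%N \notin s ->
  zsum R s N <= harmonic_number R N ^+ size s.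
Proof.
elim: s N => [|i s IHs] N //; rewrite inE negb_or => /andP[i0 s0].
rewrite exprS {1}harmonic_numberE mulr_suml; apply: ler_sum => j _.
apply: ler_pM; rewrite ?zsum_ge0 ?invr_ge0 ?exprn_ge0 //.
  rewrite lef_pV2 ?posrE ?exprn_gt0 // -[leLHS]expr1.
  by rewrite ler_weXn2l ?ler1n // lt0n eq_sym.
apply: le_trans (IHs _ s0) _; rewrite lerXn2r ?nnegrE ?harmonic_number_ge0 //.
by apply: harmonic_number_nondecreasing; exact: ltnW.
Qed.

(** The inner sums are at most powers of H_j, so the terms of the outer sum are at
    most H_j^d / j^2. *)
Lemma mzv_cvg_admissible (R : realType) a (s : seq nat) :
  (2 <= a)%N -> 0%N \notin s -> zsum R (a :: s) @ \oo --> mzv R (a :: s).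
Proof.
move=> a2 s0; apply: mzv_cvg.
have [C leC] := sum_harmonic_pow_bounded R (size s); exists C => N.
apply: le_trans (leC N); apply: ler_sum => j _; rewrite mulrC.
apply: ler_pM; rewrite ?zsum_ge0 ?invr_ge0 ?exprn_ge0 //.
  apply: le_trans (zsum_le_harmonic _ _ _ s0) _.
  by rewrite lerXn2r ?nnegrE ?harmonic_number_ge0 ?harmonic_number_leS.
by rewrite lef_pV2 ?posrE ?exprn_gt0 // ler_weXn2l ?ler1n.
Qed.

Lemma zeta2_tailE (R : realType) n :
  zeta2_tail R n = mzv R [:: 2%N] - zsum R [:: 2%N] n.
Proof.
have zsum2E m : zsum R [:: 2%N] m = \sum_(1 <= j < m.+1) j%:R ^- 2.
  by rewrite big_add1 big_mkord; apply: eq_bigr => j _; rewrite mulr1.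
apply/cvg_lim => //; have := @mzv_cvg_admissible R 2 [::] isT isT.
move=> /cvgB /(_ (@cvg_cst _ (zsum R [:: 2%N] n) _ _ _)).
apply: cvg_trans; apply: near_eq_cvg; near=> N.
have nN : (n <= N)%N by near: N; exact: nbhs_infty_ge.
rewrite !fctE /cst !zsum2E (@big_cat_nat _ _ _ n.+1 1 N.+1) //=.
by rewrite addrAC subrr add0r.
Unshelve. all: by end_near. Qed.

Lemma zeta2_tailS (R : realType) n :
  zeta2_tail R n = zeta2_tail R n.+1 + n.+1%:R ^- 2.
Proof. by rewrite !zeta2_tailE zsum_consS mulr1; ring. Qed.

Lemma zsum2_harmonic_cvg (R : realType) :
  (fun N => zsum R [:: 2%N] N + N.+1%:R^-1) @ \oo --> mzv R [:: 2%N].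
Proof.
rewrite -[X in _ --> X]addr0; apply: cvgD; last exact: cvg_harmonic.
exact: mzv_cvg_admissible.
Qed.

(** By comparison with 1/(j (j+1)), the partial sums of zeta(2) increased by
    1/(N+1) still increase to zeta(2). *)
Lemma zeta2_tail_lower (R : realType) n : n.+1%:R^-1 <= zeta2_tail R n.
Proof.
have incr : nondecreasing_seq (fun N => zsum R [:: 2%N] N + N.+1%:R^-1).
  apply/nondecreasing_seqP => N; rewrite zsum_consS mulr1 -addrA lerD2l.
  rewrite -[N.+1%:R^-1](subrK N.+2%:R^-1) invSB.
  rewrite lerD2r -exprVn expr2 ler_wpM2l ?invr_ge0 //.
  by rewrite lef_pV2 ?posrE // ler_nat.
rewrite zeta2_tailE lerBrDr addrC.
have cvgZ := zsum2_harmonic_cvg R.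
rewrite -(cvg_lim _ cvgZ) //.
by apply: (nondecreasing_cvgn_le incr); apply/cvg_ex; eexists; exact: cvgZ.
Qed.

(** By comparison with 1/(j (j-1)), the partial sums up to N + 1 increased by
    1/(N+1) decrease to zeta(2). *)
Lemma zeta2_tail_upper (R : realType) n :
  zeta2_tail R n <= n.+1%:R^-1 + n.+1%:R ^- 2.
Proof.
have decr : nonincreasing_seq (fun N => zsum R [:: 2%N] N.+1 + N.+1%:R^-1).
  apply/nonincreasing_seqP => N; rewrite [in leLHS]zsum_consS mulr1 -addrA lerD2l.
  rewrite -[N.+1%:R^-1](subrK N.+2%:R^-1) invSB.
  rewrite lerD2r -exprVn expr2 ler_wpM2r ?invr_ge0 //.
  by rewrite lef_pV2 ?posrE // ler_nat.
have cvgZ : (fun N => zsum R [:: 2%N] N.+1 + N.+1%:R^-1) @ \oo --> mzv R [:: 2%N].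
  rewrite -[X in _ --> X]addr0; apply: cvgD; last exact: cvg_harmonic.
  by rewrite (cvg_shiftS (zsum R [:: 2%N])); exact: mzv_cvg_admissible.
rewrite zeta2_tailS lerD2r zeta2_tailE lerBlDr addrC.
rewrite -(cvg_lim _ cvgZ) //.
by apply: (nonincreasing_cvgn_ge decr); apply/cvg_ex; eexists; exact: cvgZ.
Qed.

(** H_n^(k+1) / (n+1) is essentially the mean of the increments of H^(k+1), which
    are at most (k+1) H_n^k / n and tend to 0 by induction; Cesaro's theorem
    concludes. *)
Lemma harmonic_pow_div_cvg0 (R : realType) k :
  (fun N => harmonic_number R N ^+ k / N.+1%:R) @ \oo --> (0 : R).
Proof.
pose H := harmonic_number R.
elim: k => [|k IHk].
  under eq_fun do rewrite expr0 mul1r.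
  exact: cvg_harmonic.
pose u (n : nat) : R := H n.+1 ^+ k.+1 - H n ^+ k.+1.
have u0 : u @ \oo --> (0 : R).
  apply: (@squeeze_cvgr _ _ _ _ (fun=> 0)
      (fun n => 2 * k.+1%:R * (H n.+1 ^+ k / n.+2%:R))).
  - near=> n; rewrite /u subr_ge0 lerXn2r ?nnegrE ?harmonic_number_ge0 //=;
      last exact: harmonic_number_leS.
    apply: le_trans (exprB_harmonic_le _ _ _) _.
    rewrite [leRHS](_ : _ = k.+1%:R * H n.+1 ^+ k * (2 / n.+2%:R)); last by ring.
    rewrite ler_wpM2l ?mulr_ge0 ?exprn_ge0 ?harmonic_number_ge0 //.
    by rewrite ler_pdivlMr // ler_pdivrMl // -natrM ler_nat muln2 -addnn addSn ltnS leq_addl.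
  - exact: cvg_cst.
  rewrite -[X in _ --> X](mulr0 (2 * k.+1%:R)); apply: cvgMl_tmp.
  by rewrite (cvg_shiftS (fun n => H n ^+ k / n.+1%:R)).
have := cesaro u0; apply: squeeze_cvgr (cvg_cst 0).
near=> n; rewrite divr_ge0 ?exprn_ge0 ?harmonic_number_ge0 //=.
rewrite mulrC ler_wpM2l ?invr_ge0 // seriesEnat /= telescope_sumr //.
rewrite /H harmonic_number0 expr0n subr0 lerXn2r ?nnegrE ?harmonic_number_ge0 //.
exact: harmonic_number_leS.
Unshelve. all: by end_near. Qed.

(** * The truncated left-hand side and the boundary term *)

(** Abel summation: T_(n-1) - T_n = 1/n^2 moves the sum onto the powers of the
    harmonic numbers.  It is kept as one sum with the terms - H_n^p / n, so that
    it matches [rhs_truncE] term by term. *)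
Lemma lhs_truncE (R : realType) p N : (0 < p)%N ->
  \sum_(1 <= n < N.+1) harmonic_number R n ^+ p * (zeta2_tail R n - n%:R^-1)
  = \sum_(j < N) ((\sum_(n < j.+1) harmonic_number R n ^+ p) / j.+1%:R ^+ 2
                  - harmonic_number R j.+1 ^+ p / j.+1%:R)
    + zeta2_tail R N * \sum_(n < N.+1) harmonic_number R n ^+ p.
Proof.
move=> p0; rewrite big_add1 big_mkord; elim: N => [|N IHN].
  by rewrite !big_ord0 big_ord1 harmonic_number0 expr0n eqn0Ngt p0 mulr0 addr0.
rewrite big_ord_recr /= {}IHN [zeta2_tail R N]zeta2_tailS.
rewrite [in RHS]big_ord_recr [\sum_(n < N.+2) _]big_ord_recr /=.
by ring.
Qed.

Lemma ibp_defect_ge0 (R : realType) k m : 0 <= ibp_defect R k m.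
Proof.
rewrite ibp_defectE; apply: sumr_ge0 => i _.
by rewrite !mulr_ge0 ?invr_ge0 ?exprn_ge0 ?harmonic_number_ge0 ?invr_ge0.
Qed.

(** The weights i/(i+1) in [ibp_defectE] are at most 1; summing over m, the bound
    telescopes. *)
Lemma ibp_defect_le (R : realType) k m : ibp_defect R k m
  <= harmonic_number R m.+1 ^+ k - harmonic_number R m ^+ k.
Proof.
rewrite ibp_defectE harmonic_numberS -exprDn_first; apply: ler_sum => i _.
rewrite ler_piMl ?mulr_ge0 ?exprn_ge0 ?harmonic_number_ge0 ?invr_ge0 //.
by rewrite ler_pdivrMr // mul1r ler_nat.
Qed.

Lemma sum_ibp_defect_le (R : realType) k N :
  `|\sum_(m < N) ibp_defect R k m| <= harmonic_number R N ^+ k.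
Proof.
rewrite ger0_norm; last by apply: sumr_ge0 => m _; exact: ibp_defect_ge0.
elim: N => [|N IHN]; first by rewrite big_ord0 exprn_ge0 ?harmonic_number_ge0.
rewrite big_ord_recr /=; apply: le_trans (lerD IHN (ibp_defect_le _ _ _)) _.
by rewrite addrC subrK.
Qed.

Lemma cvg_sumr (R : realType) (I : eqType) (r : seq I) (f : I -> nat -> R)
    (l : I -> R) : (forall i, i \in r -> f i @ \oo --> l i) ->
  (fun N => \sum_(i <- r) f i N) @ \oo --> \sum_(i <- r) l i.
Proof.
elim: r => [|i r IHr] cvg_f.
  by under eq_fun do rewrite big_nil; rewrite big_nil; exact: cvg_cst.
under eq_fun do rewrite big_cons; rewrite big_cons; apply: cvgD.
  by apply: cvg_f; rewrite inE eqxx.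
by apply: IHr => j jr; apply: cvg_f; rewrite inE jr orbT.
Qed.

Lemma cvg_fsumr (R : realType) (I : choiceType) (A : set I) (f : I -> nat -> R)
    (l : I -> R) : finite_set A -> (forall i, A i -> f i @ \oo --> l i) ->
  (fun N => \sum_(i \in A) f i N) @ \oo --> \sum_(i \in A) l i.
Proof.
move=> finA cvg_f; under eq_fun do rewrite fsbig_finite //.
rewrite fsbig_finite //; apply: cvg_sumr => i.
by rewrite in_fset_set // inE; exact: cvg_f.
Qed.

(** By [sum_pow_ibp] the boundary term is
    ((N+1) T_N - 1) P(H_N) - T_N (c_0 + sum_k c_k sum_(m < N) E_k(m)).
    With S = sum_k |c_k| H_N^k, each of P(H_N), c_0 and the last sum is at most S
    in absolute value, the first factor is at most 1/(N+1), and T_N at most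
    2/(N+1); hence the bound 5 S / (N+1), which tends to 0. *)
Lemma boundary_cvg0 (R : realType) p : (0 < p)%N ->
  (fun N => zeta2_tail R N * (\sum_(n < N.+1) harmonic_number R n ^+ p)
            - ibp_poly R p (harmonic_number R N)) @ \oo --> (0 : R).
Proof.
move=> p0; pose c k := `|ibp_coef R p k|.
pose u N : R := \sum_(0 <= k < p.+1) 5 * c k * (harmonic_number R N ^+ k / N.+1%:R).
have u0 : u @ \oo --> (0 : R).
  rewrite -[X in _ --> X](_ : \sum_(0 <= k < p.+1) 0 = 0); last by rewrite big1.
  apply: cvg_sumr => k _; rewrite -[X in _ --> X](mulr0 (5 * c k)).
  by apply: cvgMl_tmp; exact: harmonic_pow_div_cvg0.
apply: norm_cvg0; apply: squeeze_cvgr (cvg_cst 0) u0.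
near=> N; rewrite normr_ge0 /= sum_pow_ibp //.
set P := ibp_poly _ _ _; set D := \sum_(k < p) _; set T := zeta2_tail R N.
pose S := \sum_(k < p.+1) c k * harmonic_number R N ^+ k.
have H_ge0 k : 0 <= harmonic_number R N ^+ k.
  by rewrite exprn_ge0 ?harmonic_number_ge0.
have term_ge0 k : 0 <= c k * harmonic_number R N ^+ k by rewrite mulr_ge0 ?normr_ge0.
have PS : `|P| <= S.
  apply: le_trans (ler_norm_sum _ _ _) _; apply: ler_sum => k _.
  by rewrite normrM (ger0_norm (H_ge0 _)).
have DS : `|D| <= S.
  apply: le_trans (ler_norm_sum _ _ _) _; rewrite /S big_ord_recr /=.
  apply: ler_wpDr => //; apply: ler_sum => k _.
  by rewrite normrM ler_wpM2l ?normr_ge0 ?sum_ibp_defect_le.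
have c0S : `|ibp_coef R p 0| <= S.
  rewrite /S big_ord_recl expr0 mulr1 lerDl; apply: sumr_ge0 => k _.
  exact: term_ge0.
have uE : u N = 5 * S * N.+1%:R^-1.
  rewrite /u big_mkord /S mulr_sumr mulr_suml; apply: eq_bigr => k _; ring.
have lower := zeta2_tail_lower R N; have upper := zeta2_tail_upper R N.
have N0 : N.+1%:R != 0 :> R by rewrite pnatr_eq0.
have r_le1 : N.+1%:R^-1 <= 1 :> R by rewrite invf_le1 // ler1n.
have r_ge0 : 0 <= N.+1%:R^-1 :> R by rewrite invr_ge0.
have T_le : `|T| <= 2 * N.+1%:R^-1.
  rewrite ger0_norm; last exact: le_trans lower.
  apply: le_trans upper _; rewrite -exprVn.
  by move: (N.+1%:R^-1) r_le1 r_ge0 => r; nra.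
have T1_le : `|N.+1%:R * T - 1| <= N.+1%:R^-1.
  rewrite ger0_norm; last by rewrite subr_ge0 -ler_pdivrMl ?mulr1.
  rewrite lerBlDr -ler_pdivlMl //.
  by rewrite mulrDr mulr1 addrC -expr2 exprVn.
rewrite [X in `|X|](_ : _ = (N.+1%:R * T - 1) * P - T * (ibp_coef R p 0 + D));
  last by ring.
rewrite uE; apply: le_trans (ler_normB _ _) _; rewrite !normrM.
have c0DS : `|ibp_coef R p 0 + D| <= 2 * S.
  by apply: le_trans (ler_normD _ _) _; rewrite mulr2n mulrDl mul1r lerD.
apply: le_trans (lerD (ler_pM _ _ T1_le PS) (ler_pM _ _ T_le c0DS)) _ => //.
by rewrite [leLHS](_ : _ = 5 * S * N.+1%:R^-1) //; ring.
Unshelve. all: by end_near. Qed.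

(** Only finitely many multiple zeta values occur, all with first exponent at
    least 2. *)
Lemma rhs_trunc_cvg (R : realType) p : (0 < p)%N -> rhs_trunc R p @ \oo -->
  (- (-1) ^+ p * p`!%:R * (mzv R [:: 2%N] - 1)
   - \sum_(I \in compositions p) (multinomial R p I * mzv R (incr_head I))
   - \sum_(1 <= k < p) \sum_(I \in compositions k)
       ((-1) ^+ (p - k)%N * p`!%:R / ((head 0%N I).+1%:R * k`!%:R)
        * multinomial R k I * mzv R (incr_head I))
   - \sum_(1 <= k < p) \sum_(I \in compositions k)
       ((-1) ^+ (p - k)%N * p`!%:R / ((head 0%N I).+1%:R * k`!%:R)
        * multinomial R k I * (head 0%N I)%:R * mzv R (2%N :: I)) : R).
Proof.
move=> p0.
have cvg_incr k I : (0 < k)%N -> compositions k I ->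
    zsum R (incr_head I) @ \oo --> mzv R (incr_head I).
  case: I => [|i I] k0 [I0 sumI]; first by rewrite -sumI in k0.
  move: I0; rewrite inE negb_or => /andP[i0 I0].
  by apply: mzv_cvg_admissible; rewrite // ltnS lt0n eq_sym.
apply: cvgB; first apply: cvgB; first apply: cvgB.
- apply: cvgMl_tmp; apply: cvgB; last exact: cvg_cst.
  exact: mzv_cvg_admissible.
- apply: cvg_fsumr; first exact: finite_compositions.
  by move=> I pI; apply: cvgMl_tmp; exact: (cvg_incr p).
- apply: cvg_sumr => k; rewrite mem_index_iota => /andP[k0 _].
  apply: cvg_fsumr; first exact: finite_compositions.
  by move=> I kI; apply: cvgMl_tmp; exact: (cvg_incr k).
apply: cvg_sumr => k _; apply: cvg_fsumr; first exact: finite_compositions.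
by move=> I [I0 _]; apply: cvgMl_tmp; exact: mzv_cvg_admissible.
Qed.

Theorem proposition5p3 (R : realType) (p : nat) (p_ge1 : (1 <= p)%N) :
  (fun N : nat => \sum_(1 <= n < N.+1)
     harmonic_number R n ^+ p * (zeta2_tail R n - n%:R^-1)) @ \oo -->
  (- (-1) ^+ p * p`!%:R * (mzv R [:: 2%N] - 1)
   - \sum_(I \in compositions p) (multinomial R p I * mzv R (incr_head I))
   - \sum_(1 <= k < p) \sum_(I \in compositions k)
       ((-1) ^+ (p - k)%N * p`!%:R / ((head 0%N I).+1%:R * k`!%:R)
        * multinomial R k I * mzv R (incr_head I))
   - \sum_(1 <= k < p) \sum_(I \in compositions k)
       ((-1) ^+ (p - k)%N * p`!%:R / ((head 0%N I).+1%:R * k`!%:R)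
        * multinomial R k I * (head 0%N I)%:R * mzv R (2%N :: I)) : R).
Proof.
rewrite -[X in _ --> X]addr0.
rewrite [X in X @ _ --> _](_ : _ = rhs_trunc R p \+ (fun N =>
    zeta2_tail R N * (\sum_(n < N.+1) harmonic_number R n ^+ p)
    - ibp_poly R p (harmonic_number R N))).
  by apply: cvgD; [exact: rhs_trunc_cvg|exact: boundary_cvg0].
by apply/funext => N; rewrite /= lhs_truncE // rhs_truncE //; ring.
Qed.
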